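(* Let $X$ be a metrizable space with a finitely chainable closed subspace $L$ such that $X'\subset L$. Then there is a compatible metric $\delta$ on $X$ such that for every $\varepsilon>0$, the set $X\setminus B_\delta(L,\varepsilon)$ is uniformly isolated in $(X,\delta)$. In particular, $U(X,\delta)$ is a ring.
   Context: $X'$ is the set of limit (non-isolated) points of $X$. For a metric space $(Y,d)$, $U(Y,d)$ is the set of all real-valued uniformly continuous functions on $(Y,d)$; it is a ring if it is closed under pointwise product. A metric space $(Y,d)$ is Bourbaki bounded if every $f\in U(Y,d)$ is bounded. A metrizable space $Y$ is finitely chainable if there is a compatible metric $d$ on $Y$ such that $(Y,d)$ is Bourbaki bounded. A metric is compatible if it induces the given topology. $B_\delta(L,\varepsilon)=\{x\in X:\delta(x,y)<\varepsilon\text{ for some }y\in L\}$. A set $A\subset X$ is uniformly isolated in $(X,\delta)$ if there is $\eta>0$ such that $\{y\in X:\delta(x,y)<\eta\}=\{x\}$ for every $x\in A$. *)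

(* Defs.v *)
From HB Require Import structures.
From mathcomp Require Import all_boot all_order all_algebra.
From mathcomp Require Import all_classical all_reals all_analysis.

Set Implicit Arguments.
Unset Strict Implicit.
Unset Printing Implicit Defensive.

Import Order.TTheory GRing.Theory Num.Theory.
Import numFieldNormedType.Exports.

Local Open Scope classical_set_scope.
Local Open Scope ring_scope.

Record metric_on (R : realType) (Y : choiceType) := MetricOn {
  dist :> Y -> Y -> R ;
  distxx : forall x, dist x x = 0 ;
  dist_positivity : forall x y, dist x y = 0 -> x = y ;
  dist_sym : forall x y, dist x y = dist y x ;
  dist_triangle : forall y x z, dist x z <= dist x y + dist y z
}.

(* [metrized d] is the metric space (Y, d): the same points as Y, but with the
   topology and the uniformity induced by d, whatever topology Y carries. *)
Definition metrized (R : realType) (Y : choiceType) (d : metric_on R Y) : Type :=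
  Y.

HB.instance Definition _ (R : realType) (Y : choiceType) (d : metric_on R Y) :=
  Choice.on (metrized d).
HB.instance Definition _ (R : realType) (Y : choiceType) (d : metric_on R Y) :=
  isMetric.Build R (metrized d)
    (distxx d) (@dist_positivity _ _ d) (dist_sym d) (dist_triangle d).

Definition compatible (R : realType) (Y : topologicalType)
    (d : metric_on R Y) : Prop :=
  forall A : set Y, open A <-> open (A : set (metrized d)).

Definition metrizable (R : realType) (Y : topologicalType) : Prop :=
  exists d : metric_on R Y, compatible d.

Definition ucont (R : realType) (M : metricType R) : set (M -> R) :=
  [set f | unif_continuous f].

Definition ucont_ring (R : realType) (M : metricType R) : Prop :=
  forall f g : M -> R, ucont f -> ucont g -> ucont (f \* g).

Definition Bourbaki_bounded (R : realType) (M : metricType R) : Prop :=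
  forall f : M -> R, ucont f -> bounded_fun f.

Definition finitely_chainable (R : realType) (Y : topologicalType) : Prop :=
  exists2 d : metric_on R Y, compatible d & Bourbaki_bounded (metrized d).

Definition enlargement (R : realType) (M : metricType R) (L : set M) (e : R) :
    set M :=
  [set x | exists2 y, L y & mdist x y < e].

Definition uniformly_isolated (R : realType) (M : metricType R) (A : set M) :
    Prop :=
  exists2 eta : R, 0 < eta &
    forall x, A x -> [set y | mdist x y < eta] = [set x].

(* Main.v *)
(* Let [rho] metrize X and let [d] be a Bourbaki bounded metric of L. Choose
   [r : X -> L] with [rho x (r x) <= 2 * rho x a] for all a in L; in particular
   r fixes L. Put [h x = rho x (r x)], which vanishes exactly on L, and
     delta x y = d (r x) (r y) + h x + h y   for x <> y,
   so that every point x outside L sits at the end of a spike of length [h x]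
   attached to L at [r x]. Then delta extends d, the delta-ball of radius [h x]
   around x is {x}, and [h x >= e] as soon as x is not in the e-enlargement of L.
   A uniformly continuous f is bounded on L, hence on some enlargement of L,
   and products of functions bounded there are uniformly continuous because
   the complement is uniformly isolated. If L is empty, X is discrete and
   [d (r x) (r y)], [h x] are replaced by 0, 1. *)

Require Import Defs.
From HB Require Import structures.
From mathcomp Require Import all_boot all_order all_algebra.
From mathcomp Require Import all_classical all_reals all_analysis.
From mathcomp Require Import lra.

Set Implicit Arguments.
Unset Strict Implicit.
Unset Printing Implicit Defensive.

Import Order.TTheory GRing.Theory Num.Theory.
Import numFieldNormedType.Exports.

Local Open Scope classical_set_scope.
Local Open Scope ring_scope.

Lemma dist_ge0 (R : realType) (Y : choiceType) (d : metric_on R Y) (x y : Y) :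
  0 <= d x y.
Proof. exact: (@mdist_ge0 R (metrized d)). Qed.

Lemma nbhs_metrizedP (R : realType) (Y : choiceType) (d : metric_on R Y)
    (x : metrized d) (A : set (metrized d)) :
  nbhs x A <-> exists2 e : R, 0 < e & forall y, d x y < e -> A y.
Proof.
split=> [/nbhs_ballP[e e0 xeA]|[e e0 xeA]].
  by exists e => // y xye; apply: xeA; rewrite ballEmdist.
by apply/nbhs_ballP; exists e => // y; rewrite ballEmdist; exact: xeA.
Qed.

Lemma compatible_nbhsP (R : realType) (Y : topologicalType)
    (d : metric_on R Y) :
  compatible d <-> forall (x : Y) (A : set Y),
    nbhs x A <-> exists2 e : R, 0 < e & forall y, d x y < e -> A y.
Proof.
split=> [cd x A|nd A].
  apply: iff_trans (@nbhs_metrizedP R Y d x A).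
  rewrite !nbhsE; split=> -[B [oB Bx] BA]; exists B => //; split=> //.
    exact/(cd B).
  exact/(cd B).
by rewrite !openE; split=> oA x /oA; rewrite /interior /= => Ax;
  [apply/nbhs_metrizedP/nd | apply/nd/nbhs_metrizedP].
Qed.

Lemma ucontP (R : realType) (M : metricType R) (f : M -> R) :
  ucont f <-> forall e : R, 0 < e -> exists2 eta : R, 0 < eta &
    forall x y, mdist x y < eta -> `|f x - f y| < e.
Proof.
rewrite /ucont /= (@unif_continuousP R M R f); split=> uf e e0.
  have [eta eta0 fe] := uf _ e0.
  by exists eta => // x y xy; apply: (fe (x, y)); rewrite /= ballEmdist.
have [eta eta0 fe] := uf _ e0.
by exists eta => // -[x y] /=; rewrite ballEmdist; exact: fe.
Qed.

(** Two distinct points closer than the isolation radius both lie in an enlargement of [L] on which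
    [f] and [g] are bounded, so the usual product estimate applies to them. *)
Lemma ucont_ring_bounded (R : realType) (M : metricType R) (L : set M) :
  (forall f : M -> R, ucont f ->
     exists2 B : R, 0 <= B & forall x, L x -> `|f x| <= B) ->
  (forall e : R, 0 < e -> uniformly_isolated (~` enlargement L e)) ->
  ucont_ring M.
Proof.
move=> bdL isoL.
(* uniform continuity keeps the bound on [L], up to 1, on some enlargement *)
have bd f : ucont f -> exists2 B : R, 0 < B &
    exists2 e : R, 0 < e & forall x, enlargement L e x -> `|f x| <= B.
  move=> uf; have [B B0 fB] := bdL _ uf.
  move/ucontP: uf => /(_ 1 ltr01)[e e0 fe].
  exists (B + 1); first by rewrite ltr_wpDl.
  exists e => // x [y Ly /fe xy]; have := fB _ Ly.
  by have := ler_normD (f x - f y) (f y); rewrite subrK; lra.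
move=> f g uf ug.
have [B B0 [a a0 fB]] := bd _ uf; have [C C0 [b b0 gC]] := bd _ ug.
have c0 : 0 < Num.min a b by rewrite lt_min a0.
have [eta eta0 iso] := isoL _ c0.
apply/ucontP => e e0.
(* Each term of [(f x - f y) * g x + f y * (g x - g y)] is to stay below [e / 2], given [C] bounding
   [g] at [x] and [B] bounding [f] at [y]. *)
have e1 : 0 < e / (2 * C) by rewrite divr_gt0// mulr_gt0.
have e2 : 0 < e / (2 * B) by rewrite divr_gt0// mulr_gt0.
move/ucontP: uf => /(_ _ e1)[s s0 fs].
move/ucontP: ug => /(_ _ e2)[t t0 gt].
exists (Num.min eta (Num.min s t)); first by rewrite !lt_min eta0 s0.
move=> x y; rewrite !lt_min => /and3P[xeta xs xt].
have [->|xy] := eqVneq x y; first by rewrite subrr normr0.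
have near z : (forall w, mdist z w < eta -> w = z) \/
    (`|f z| <= B /\ `|g z| <= C).
  have [[w Lw]|zL] := pselect (enlargement L (Num.min a b) z).
    rewrite lt_min => /andP[za zb]; right.
    by split; [apply: fB; exists w | apply: gC; exists w].
  left=> w zw; have : [set y | mdist z y < eta] w by [].
  by rewrite (iso _ zL).
have [/(_ _ xeta) yx|[_ gx]] := near x; first by rewrite yx eqxx in xy.
have [|[fy _]] := near y.
  by move=> /(_ x); rewrite metric_sym => /(_ xeta) yx; rewrite yx eqxx in xy.
have -> : (f \* g) x - (f \* g) y = (f x - f y) * g x + f y * (g x - g y).
  by rewrite /= mulrBl mulrBr addrA subrK.
have := fs _ _ xs; have := gt _ _ xt.
rewrite !ltr_pdivlMr ?mulr_gt0// => gxy fxy.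
have := ler_normD ((f x - f y) * g x) (f y * (g x - g y)); rewrite !normrM.
have := ler_wpM2l (normr_ge0 (f x - f y)) gx.
have := ler_wpM2r (normr_ge0 (g x - g y)) fy.
lra.
Qed.

Section fan_metric.
Variables (R : realType) (Y : choiceType) (D : Y -> Y -> R) (h : Y -> R).
Hypotheses (Dxx : forall x, D x x = 0) (D_sym : forall x y, D x y = D y x).
Hypothesis D_triangle : forall y x z, D x z <= D x y + D y z.
Hypothesis h_ge0 : forall x, 0 <= h x.
Hypothesis D_positivity :
  forall x y, h x = 0 -> h y = 0 -> D x y = 0 -> x = y.

(** [D] is only a pseudometric, since it will be pulled back along a non-injective map. The spikes
    separate distinct points unless both have height zero, which is where [D_positivity] takes
    over. *)
Definition fan_dist (x y : Y) : R :=
  D x y + (if x == y then 0 else h x + h y).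

Let D_ge0 x y : 0 <= D x y.
Proof. by have := D_triangle y x x; rewrite Dxx (D_sym y x); lra. Qed.

Let fan_distxx x : fan_dist x x = 0.
Proof. by rewrite /fan_dist Dxx eqxx addr0. Qed.

Lemma fan_dist_neq x y : x != y -> fan_dist x y = D x y + (h x + h y).
Proof. by rewrite /fan_dist => /negbTE ->. Qed.

Let fan_dist_positivity x y : fan_dist x y = 0 -> x = y.
Proof.
have [//|xy] := eqVneq x y; rewrite fan_dist_neq// => Dh.
have [] := (D_ge0 x y, (h_ge0 x, h_ge0 y)).
by move=> ? [? ?]; apply: D_positivity; lra.
Qed.

Let fan_dist_sym x y : fan_dist x y = fan_dist y x.
Proof. by rewrite /fan_dist D_sym eq_sym [h x + _]addrC. Qed.

Let fan_dist_triangle y x z : fan_dist x z <= fan_dist x y + fan_dist y z.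
Proof.
rewrite /fan_dist; have := D_triangle y x z.
have := h_ge0 x; have := h_ge0 y; have := h_ge0 z.
have [->|xy] := eqVneq x y; first by have [->|_] := eqVneq y z; lra.
by have [->|yz] := eqVneq y z; have [?|?] := eqVneq x _; lra.
Qed.

Definition fan_metric : metric_on R Y :=
  MetricOn fan_distxx fan_dist_positivity fan_dist_sym fan_dist_triangle.

Lemma fan_metric_ball x e : e <= h x -> forall y, fan_metric x y < e -> y = x.
Proof.
move=> ehx y; have [//|xy] := eqVneq y x.
rewrite /= fan_dist_neq 1?eq_sym// => xye; exfalso; move: xye.
by have := D_ge0 x y; have := h_ge0 y; lra.
Qed.

Lemma fan_metric_uniformly_isolated (A : set (metrized fan_metric)) (e : R) :
  0 < e -> (forall x, A x -> e <= h x) -> uniformly_isolated A.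
Proof.
move=> e0 Ah; exists e => // x Ax; apply/seteqP; split=> [y /=|_ ->/=].
  by apply: fan_metric_ball; exact: Ah.
by rewrite mdistxx.
Qed.

End fan_metric.

(** Where [h] is positive the point is isolated for both topologies; where [h x = 0] the distance
    from [x] is exactly [D x y + h y], including at [y = x]. *)
Lemma fan_metric_compatible (R : realType) (Y : topologicalType)
    (D : Y -> Y -> R) (h : Y -> R) Dxx D_sym D_triangle h_ge0 D_positivity :
  (forall x, 0 < h x -> nbhs x [set x]) ->
  (forall x, h x = 0 -> forall A : set Y, nbhs x A <->
     exists2 e : R, 0 < e & forall y, D x y + h y < e -> A y) ->
  compatible (@fan_metric R Y D h Dxx D_sym D_triangle h_ge0 D_positivity).
Proof.
move=> isoh nbh; apply/compatible_nbhsP => x A.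
have : 0 <= h x by [].
rewrite le_eqVlt => /predU1P[/esym hx|hx].
  have DhE y : fan_dist D h x y = D x y + h y.
    rewrite /fan_dist; case: eqVneq => [<-|_]; first by rewrite hx.
    by rewrite hx add0r.
  rewrite nbh//; split=> -[e e0 xeA]; exists e => // y.
    by rewrite /= DhE; exact: xeA.
  by rewrite -DhE; exact: xeA.
split=> [/nbhs_singleton Ax|[e e0 xeA]].
  by exists (h x) => // y /fan_metric_ball ->.
by apply: filterS (isoh _ hx) => _ ->; apply: xeA; rewrite distxx.
Qed.

(** A nearest point of [L] may not exist. The factor 2 leaves room for an almost nearest one, as
    closedness makes the distance to [L] positive off [L]. *)
Lemma near_retraction (R : realType) (X : topologicalType) (L : set X)
    (rho : metric_on R X) (a0 : set_type L) :
  compatible rho -> closed L -> exists r : X -> set_type L,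
    forall x (a : set_type L), rho x (val (r x)) <= 2 * rho x (val a).
Proof.
move=> /compatible_nbhsP rhoP cL.
suff ex x : exists b : set_type L, forall a : set_type L,
    rho x (val b) <= 2 * rho x (val a).
  by have [r rP] := choice ex; exists r.
have [Lx|Lx] := pselect (L x).
  exists (SigSub (mem_set Lx)) => a /=.
  by rewrite distxx mulr_ge0// dist_ge0.
have /rhoP[e e0 xeL] : nbhs x (~` L).
  by apply: open_nbhs_nbhs; split=> //; exact: closed_openC.
pose E := [set rho x (val a) | a in [set: set_type L]].
have E0 : nonempty E by exists (rho x (val a0)), a0.
have lbE : lbound E e.
  move=> _ [a _ <-]; rewrite leNgt; apply/negP => /xeL; apply.
  exact: set_valP.
have infE : 0 < inf E by apply: lt_le_trans e0 _; exact: lb_le_inf.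
have hE : has_inf E by split=> //; exists e.
(* The tolerance is [inf E] itself, so [b] lies within [2 * inf E] of [x]. *)
have [_ [b _ <-] xb] := inf_adherent infE hE.
exists b => a; apply: le_trans (ltW xb) _.
have : inf E <= rho x (val a) by apply: ge_inf; [exists e|exists a].
lra.
Qed.

(** The restriction of [rho] metrizes the subspace [L], which makes it topologically comparable with
    [d]. *)
Lemma nbhs_set_typeP (R : realType) (X : topologicalType) (L : set X)
    (rho : metric_on R X) (a : set_type L) (A : set (set_type L)) :
  compatible rho ->
  nbhs a A <-> exists2 e : R, 0 < e & forall b, rho (val a) (val b) < e -> A b.
Proof.
move=> /compatible_nbhsP rhoP; split.
  rewrite nbhsE => -[_ [[B oB <-] aB] BA].
  have /rhoP[e e0 aeB] : nbhs (val a) B by apply: open_nbhs_nbhs.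
  by exists e => // b /aeB; exact: BA.
move=> [e e0 aeA].
have ae : nbhs (val a) [set y | rho (val a) y < e] by apply/rhoP; exists e.
have : nbhs a (val @^-1` [set y | rho (val a) y < e]).
  exact: (@initial_continuous (set_type L) X val a).
by apply: filterS => b; exact: aeA.
Qed.

Theorem theorem3p13 (R : realType) (X : topologicalType) (L : set X)
    (X_metrizable : metrizable R X)
    (L_closed : closed L)
    (L_fc : finitely_chainable R (set_type L))
    (X'_sub_L : limit_point [set: X] `<=` L) :
  exists delta : metric_on R X,
    [/\ compatible delta,
        forall e : R, 0 < e ->
          uniformly_isolated (~` enlargement (L : set (metrized delta)) e)
      & ucont_ring (metrized delta)].
Proof.
have [rho rhoC] := X_metrizable; have /compatible_nbhsP rhoP := rhoC.
have [d /compatible_nbhsP dP bbd] := L_fc.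
have isoX x : ~ L x -> nbhs x [set x].
  move=> Lx; apply: contrapT => nx; apply: Lx; apply: X'_sub_L => U xU.
  apply: contrapT => nU; apply: nx; apply: filterS xU => y Uy.
  by apply: contrapT => /eqP yx; apply: nU; exists y.
have [L0|/set0P[a0 La0]] := eqVneq L set0.
  (* There is no point of [L] to retract to; the fan metric below takes the value 2 on all pairs of
     distinct points. *)
  have le00 : 0 <= 0 + 0 :> R by rewrite addr0.
  pose delta := @fan_metric R X (fun _ _ => 0) (fun=> 1)
    (fun=> erefl) (fun _ _ => erefl) (fun _ _ _ => le00) (fun=> ler01)
    (fun _ _ one0 => ltac:(by move/eqP: one0; rewrite oner_eq0)).
  have iso e : 0 < e ->
      uniformly_isolated (~` enlargement (L : set (metrized delta)) e).
    by move=> _; apply: (@fan_metric_uniformly_isolated _ _ _ _ _ _ _ _ _ _ 1).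
  exists delta; split=> //.
    apply: fan_metric_compatible => [x _|x /eqP]; last by rewrite oner_eq0.
    by apply: isoX; rewrite L0.
  by apply: ucont_ring_bounded iso => f _; exists 0 => // x; rewrite L0.
have [r rP] := near_retraction (SigSub (mem_set La0)) rhoC L_closed.
pose D x y := d (r x) (r y); pose h x := rho x (val (r x)).
have h_ge0 x : 0 <= h x by exact: dist_ge0.
(* Testing [rP] at [val a] against [a] itself forces a zero distance. *)
have rK (a : set_type L) : r (val a) = a.
  apply/val_inj/esym/(dist_positivity (m := rho))/eqP.
  by rewrite eq_le dist_ge0 andbT (le_trans (rP _ a))// distxx mulr0.
have hL a : L a -> h a = 0 /\ a = val (r a).
  move=> La; have := rK (SigSub (mem_set La)); rewrite /h /= => ->.
  by rewrite distxx.
have h0 x : h x = 0 -> L x.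
  by move=> /dist_positivity ->; exact: set_valP.
have Dpos x y : h x = 0 -> h y = 0 -> D x y = 0 -> x = y.
  move=> /dist_positivity hx /dist_positivity hy /dist_positivity rxy.
  by rewrite hx hy rxy.
pose delta := @fan_metric R X D h (fun=> distxx _ _) (fun _ _ => dist_sym _ _ _)
  (fun _ _ _ => dist_triangle _ _ _ _) h_ge0 Dpos.
have delta_r x : delta x (val (r x)) <= h x.
  have [rx _] := hL _ (set_valP (r x)).
  rewrite /delta /= /fan_dist /D rK distxx add0r rx addr0.
  by case: ifP.
have deltaL (a b : set_type L) : delta (val a) (val b) = d a b.
  have [ha _] := hL _ (set_valP a); have [hb _] := hL _ (set_valP b).
  by rewrite /delta /= /fan_dist /D !rK ha hb addr0 if_same addr0.
have iso e : 0 < e ->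
    uniformly_isolated (~` enlargement (L : set (metrized delta)) e).
  move=> e0; apply: (@fan_metric_uniformly_isolated _ _ _ _ _ _ _ _ _ _ e e0).
  move=> x xL; rewrite leNgt; apply/negP => hx; apply: xL.
  exists (val (r x)); first exact: set_valP.
  exact: le_lt_trans (delta_r x) hx.
exists delta; split=> //.
  apply: fan_metric_compatible => [x hx|x hx A].
    by apply: isoX => /hL[hx0 _]; rewrite hx0 ltxx in hx.
  have [_ xr] := hL _ (h0 _ hx).
  (* As [x] is in [L], it competes with [r y] in [rP]; hence [h y] tends to 0 as [y] tends to
     [x]. *)
  have h_le y : h y <= 2 * rho x y.
    by apply: le_trans (rP y (r x)) _; rewrite -xr dist_sym.
  split.
    move=> /rhoP[e e0 xeA].
    (* One half of [e] is for [rho x (val (r y))], controlled through [d], and the other for the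
       spike [h y]. *)
    have rxe : nbhs (r x) [set b | rho x (val b) < e / 2].
      apply/(nbhs_set_typeP _ _ rhoC).
      exists (e / 2); first by rewrite divr_gt0.
      by move=> b; rewrite -xr.
    have /dP[s s0 rs] := rxe.
    exists (Num.min s (e / 2)); first by rewrite lt_min s0 divr_gt0.
    move=> y; rewrite lt_min => /andP[ys ye]; apply: xeA.
    have : rho x (val (r y)) < e / 2.
      by apply: rs; apply: le_lt_trans ys; rewrite lerDl.
    have := dist_triangle rho (val (r y)) x y.
    rewrite [rho (val _) y]dist_sym -/(h y).
    by have := dist_ge0 d (r x) (r y); rewrite -/(D x y); lra.
  move=> [e e0 xeA].
  have rxe : nbhs (r x) [set b | d (r x) b < e / 2].
    by apply/dP; exists (e / 2) => //; rewrite divr_gt0.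
  have [s s0] := (nbhs_set_typeP _ _ rhoC).1 rxe; rewrite -xr => rs.
  (* By [h_le], [rho x (val (r y))] is at most [3 * rho x y], hence below [s], and [h y] is below
     [e / 2]. *)
  apply/rhoP; exists (Num.min (s / 3) (e / 4)).
    by rewrite lt_min !divr_gt0.
  move=> y; rewrite lt_min => /andP[ys ye]; apply: xeA.
  have := h_le y; have := dist_triangle rho y x (val (r y)).
  rewrite -/(h y) => xry hy.
  have /rs : rho x (val (r y)) < s by lra.
  by rewrite /= -/(D x y); lra.
apply: ucont_ring_bounded iso => f /ucontP uf.
(* Since [delta] restricts to [d] on [L], uniform continuity passes to the restriction of [f], and
   Bourbaki boundedness applies. *)
have /bbd : ucont (f \o val : metrized d -> R).
  apply/ucontP => e /uf[s s0 fs]; exists s => // a b ab.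
  by apply: fs; rewrite -[mdist a b]/(d a b) -deltaL in ab.
(* [fB] gives a bound only for reals strictly above [B], and [B] may be negative. *)
move=> [B [_ fB]]; exists (`|B| + 1) => [|x Lx]; first by rewrite addr_ge0.
apply: (fB (`|B| + 1) _ (SigSub (mem_set Lx)) I).
by have := ler_norm B; lra.
Qed.
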